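(* Let $\beta\in B$. If $\mathrm{dom}(J_\beta)$ is nonempty, then $$\mathrm{dom}(J_\beta)=\bigcup_{F\in\boldsymbol F_\beta}\mathrm{ri}(F).$$
   Context: Setting. $(Z,\mathcal Z)$ is a measurable space with a $\sigma$-finite measure $\mu$, and $\varphi\colon Z\to\mathbb R^d$ is $\mathcal Z$-measurable (the moment mapping). $\Gamma$ is the class of functions $\gamma\colon\mathbb R\to(-\infty,+\infty]$ that are finite and strictly convex on $(0,+\infty)$, equal to $+\infty$ for $t<0$, and satisfy $\gamma(0)=\lim_{t\downarrow0}\gamma(t)$. $B$ is the class of functions $\beta\colon Z\times\mathbb R\to(-\infty,+\infty]$ such that $\beta(\cdot,t)$ is $\mathcal Z$-measurable for each $t\in\mathbb R$ and $\beta(z,\cdot)\in\Gamma$ for each $z\in Z$. Convention: an integral whose positive and negative parts are both infinite equals $+\infty$. $\mathcal G$ is the linear space of $\mathcal Z$-measurable $g\colon Z\to\mathbb R$ with $\varphi g$ $\mu$-integrable; $\mathcal G_a=\{g\in\mathcal G\colon\int_Z\varphi g\,d\mu=a\}$; the superscript $+$ denotes the subset of nonnegative functions. $H_\beta(g)=\int_Z\beta(z,g(z))\,\mu(dz)$, and the value function is $J_\beta(a)=\inf_{g\in\mathcal G_a^+}H_\beta(g)$, $a\in\mathbb R^d$ ($\inf\emptyset=+\infty$). $\mathrm{dom}(J_\beta)=\{a\colon J_\beta(a)<+\infty\}$. The $\varphi$-cone of $\mu$ is $\mathrm{cn}_\varphi(\mu)=\{\int_Z\varphi g\,d\mu\colon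 g\in\mathcal G^+\}$, a convex cone. A face of a convex set $C\subseteq\mathbb R^d$ is a nonempty convex subset $F\subseteq C$ such that every closed line segment in $C$ with a relative interior point in $F$ is contained in $F$ ($C$ itself is allowed). $\mathrm{cl}$ and $\mathrm{ri}$ denote closure and relative interior. For a face $F$ of $\mathrm{cn}_\varphi(\mu)$ let $\omega_{F,\beta}=\int_{\{\varphi\notin\mathrm{cl}(F)\}}\beta(z,0)\,\mu(dz)$, and let $\boldsymbol F_\beta$ be the family of faces $F$ of $\mathrm{cn}_\varphi(\mu)$ with $\omega_{F,\beta}<+\infty$. *)

(* Defs.v *)
From HB Require Import structures.
From mathcomp Require Import all_boot all_order all_algebra.
From mathcomp Require Import all_classical all_reals all_analysis.
From mathcomp Require Import measurable_realfun.

Set Implicit Arguments.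
Unset Strict Implicit.
Unset Printing Implicit Defensive.

Import Order.TTheory GRing.Theory Num.Theory.
Import numFieldNormedType.Exports.

Local Open Scope classical_set_scope.
Local Open Scope ring_scope.

Section convex_geometry.
Context {R : realType} {n : nat}.
Implicit Types (x y : 'rV[R]_n) (A C F : set 'rV[R]_n).

Definition affine_set A : Prop :=
  forall x y (t : R), A x -> A y -> A (t *: x + (1 - t) *: y).

Definition affine_hull A : set 'rV[R]_n := smallest affine_set A.

(* Interior of A for the topology induced on its affine hull. *)
Definition ri A : set 'rV[R]_n :=
  [set x | affine_hull A x /\ within (affine_hull A) (nbhs x) A].

Definition segment x y : set 'rV[R]_n :=
  [set t *: x + (1 - t) *: y | t in [set t : R | 0 <= t <= 1]].

Definition face C F : Prop :=
  [/\ F !=set0, convex_set (F : set (convex_lmodType 'rV[R]_n)), F `<=` C &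
      forall x y, segment x y `<=` C ->
        ri (segment x y) `&` F !=set0 -> segment x y `<=` F].

End convex_geometry.

(* The integral of f over D when the positive and negative parts do not both
   integrate to +oo, and +oo otherwise; \int alone yields -oo = +oo - +oo in
   that last case. *)
Definition cintegral {d} {T : measurableType d} {R : realType}
    (mu : {measure set T -> \bar R}) (D : set T) (f : T -> \bar R) : \bar R :=
  (if (\int[mu]_(x in D) (f^\+ x) == +oo) && (\int[mu]_(x in D) (f^\- x) == +oo)
   then +oo else \int[mu]_(x in D) f x)%E.

Definition strictly_convex_on {R : realType} (D : set R) (f : R -> \bar R) :
    Prop :=
  forall s t l : R, D s -> D t -> s != t -> 0 < l < 1 ->
    (f (l * s + (1 - l) * t)%R < l%:E * f s + (1 - l)%:E * f t)%E.

Definition classGamma {R : realType} : set (R -> \bar R) :=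
  [set gam |
    [/\ forall t : R, gam t != -oo%E,
        forall t : R, 0 < t -> gam t \is a fin_num,
        strictly_convex_on [set t | 0 < t] gam,
        forall t : R, t < 0 -> gam t = +oo%E &
        gam t @[t --> 0^'+] --> gam 0]].

Definition classB {d} {Z : measurableType d} {R : realType} :
    set (Z -> R -> \bar R) :=
  [set beta : Z -> R -> \bar R |
    (forall t, measurable_fun [set: Z] (beta ^~ t)) /\
    (forall z, classGamma (beta z))].

Definition borel_measurable {d} {Z : measurableType d} {R : realType} {n : nat}
    (phi : Z -> 'rV[R]_n) : Prop :=
  measurable_fun [set: Z]
    (phi : Z -> g_sigma_algebraType (@open 'rV[R]_n)).

Section value_function.
Context {d} {Z : measurableType d} {R : realType} {n : nat}.
Variables (mu : {measure set Z -> \bar R}) (phi : Z -> 'rV[R]_n).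
Implicit Types (g : Z -> R) (a : 'rV[R]_n) (beta : Z -> R -> \bar R).

(* phi g is mu-integrable in the coordinatewise sense. *)
Definition Gspace : set (Z -> R) :=
  [set g | measurable_fun [set: Z] g /\
           forall i, mu.-integrable [set: Z] (fun z => (phi z 0 i * g z)%:E)].

Definition Gplus : set (Z -> R) := [set g | Gspace g /\ forall z, 0 <= g z].

Definition moment g : 'rV[R]_n :=
  \row_i (\int[mu]_(z in [set: Z]) (phi z 0 i * g z)).

Definition Gplus_at a : set (Z -> R) := [set g | Gplus g /\ moment g = a].

Definition H beta g : \bar R := cintegral mu [set: Z] (fun z => beta z (g z)).

Definition J beta a : \bar R := ereal_inf [set H beta g | g in Gplus_at a].

Definition domJ beta : set 'rV[R]_n := [set a | (J beta a < +oo)%E].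

Definition phi_cone : set 'rV[R]_n := [set moment g | g in Gplus].

Definition omega beta (F : set 'rV[R]_n) : \bar R :=
  cintegral mu [set z | ~ closure F (phi z)] (beta ^~ 0).

Definition Fbeta beta : set (set 'rV[R]_n) :=
  [set F | face phi_cone F /\ (omega beta F < +oo)%E].

End value_function.

(* Main.v *)
(* Write C for the phi-cone and, for a face F of C, W for {phi \in cl F}.
   If moment g = a and H(g) < +oo, let F be the face of C with a in ri F. All
   the partial moments of g lie in F, so g vanishes almost everywhere off W,
   where beta(., 0) therefore coincides with beta(., g).
   Conversely, let F have finite omega and let D be the convex set of moments
   of the g >= 0 vanishing off W with H(g) < +oo. It is contained in F, and
   every linear functional bounded below on D is bounded below on F by the same
   constant. Hence a point of ri F outside D could not be properly separated
   from D, contradicting the separation theorem. *)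
Require Import Defs.
From HB Require Import structures.
From mathcomp Require Import all_boot all_order all_algebra.
From mathcomp Require Import all_classical all_reals all_analysis.
From mathcomp Require Import measurable_realfun ring lra.

Set Implicit Arguments.
Unset Strict Implicit.
Unset Printing Implicit Defensive.

Import Order.TTheory GRing.Theory Num.Theory.
Import numFieldNormedType.Exports.

Local Open Scope classical_set_scope.
Local Open Scope ring_scope.

(** * Relative interiors *)

(** Neither [F] nor [D] need be closed, so density of [D] in [F] alone does not decide whether a
    point of [ri F] lies in [D]. Weak separation would not help either: a functional constant on [F]
    gives no contradiction. Hence the insistence on strict inequality at one point of [D]. That
    moments of functions supported in W lie in [F], although [phi] is only known to take values in
    cl F there, rests on the identity F = C ∩ span F for faces of a convex cone. Passing from [D] to
    [F] meets two obstacles: [beta z 0] may be infinite on W, which a small positive perturbation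
    cures, and a finite [beta z (g z)] may fail to be integrable, which is cured by truncating at
    multiples of a strictly positive integrable function, available by sigma-finiteness. The
    truncation needs some member of [D] to fall back on; nonemptiness of the domain supplies it. *)

Lemma continuous_mulmx (R : realType) (n p : nat) (l : 'M[R]_(n, p)) i j :
  continuous (fun y : 'rV[R]_n => (y *m l) i j).
Proof.
move=> a; rewrite /continuous_at mxE; under eq_fun do rewrite mxE.
apply: (@cvg_big _ _ _ _ _ _ _ (nbhs a)) => [|k _]; first exact: add_continuous.
by apply: cvgMr_tmp; exact: coord_continuous.
Qed.

Section convex_geometry.
Context {R : realType} {n : nat}.
Implicit Types (x y z a : 'rV[R]_n) (A C D F K S : set 'rV[R]_n).

Lemma convex_rVP A : convex_set (A : set (convex_lmodType 'rV[R]_n)) <->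
  (forall x y (t : R), A x -> A y -> 0 <= t -> t <= 1 ->
     A (t *: x + (1 - t) *: y)).
Proof.
split=> [cA x y t Ax Ay t0 t1|cA].
  pose l := Itv01 t0 t1.
  have /set_mem := cA x y l (mem_set Ax) (mem_set Ay).
  by [].
move=> x y l /set_mem Ax /set_mem Ay; apply/mem_set.
by apply: (cA x y l%:num).
Qed.

(** A matrix of maximal rank with rows in [S] works: appending [x] from [S] cannot raise the rank,
    so [x] is in its row space. Taking rows from [S] itself, not from its span, keeps positive
    combinations of them inside a cone [S]. *)
Lemma spanning_rows S : exists m (B : 'M[R]_(m, n)),
  (forall i, S (row i B)) /\ (forall x, S x -> (x <= B)%MS).
Proof.
pose P k := `[< exists m (B : 'M[R]_(m, n)),
                  (forall i, S (row i B)) /\ \rank B = k >].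
have P0 : exists k, P k.
  exists 0; apply/asboolP; exists 0, 0; split; first by case.
  exact: mxrank0.
have Pn k : P k -> (k <= n)%N.
  by move=> /asboolP[m [B [_ <-]]]; exact: rank_leq_col.
case: (ex_maxnP P0 Pn) => k /asboolP[m [B [SB rB]]] kmax.
exists m, B; split=> // x Sx; apply: contrapT => /negP xB.
have : P (\rank (col_mx B x)).
  apply/asboolP; exists (m + 1)%N, (col_mx B x); split=> // i.
  rewrite -[i]splitK; case: (fintype.split i) => j /=.
    by rewrite rowKu.
  by rewrite rowKd; rewrite (_ : row j x = x)//; apply/rowP => l;
    rewrite !mxE ord1.
move/kmax; rewrite -rB -addsmxE leqNgt => /negP; apply.
rewrite ltn_neqAle mxrankS ?addsmxSl// andbT.
apply: contra xB => /eqP rBx.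
have [_] := mxrank_leqif_eq (addsmxSl B x).
by rewrite rBx eqxx => /esym/eqmxP ->; exact: addsmxSr.
Qed.

(** The hypothesis says that [x] is outside the span of [S]. The columns of the cokernel of a
    spanning matrix annihilate [S], and one of them does not annihilate [x]. *)
Lemma exists_annihilator S x :
  (forall m (B : 'M[R]_(m, n)), (forall i, S (row i B)) -> ~ (x <= B)%MS) ->
  exists l : 'cV[R]_n, (forall y, S y -> y *m l = 0) /\ x *m l != 0.
Proof.
move=> Sx; have [m [B [SB Bs]]] := spanning_rows S.
have /negP := Sx m B SB; rewrite submxE => xB.
have [j xj] : exists j, x *m col j (cokermx B) != 0.
  apply: contrapT => /forallNP h; move/negP: xB; apply;
    apply/eqP/matrixP => i j.
  have /negP/negPn/eqP := h j.
  by rewrite colE mulmxA -colE => /colP/(_ i); rewrite !mxE.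
exists (col j (cokermx B)); split=> // y /Bs; rewrite submxE => /eqP yB.
by rewrite colE mulmxA yB mul0mx.
Qed.

(** The line through [y] and [x] stays in the affine hull and is continuous at [t = 0], so it
    remains in [S] a little beyond [x]. *)
Lemma ri_core S x y : ri S x -> S y ->
  exists2 t : R, 0 < t & S (x + t *: (x - y)).
Proof.
move=> [Ax Sx] Sy.
have Ay : affine_hull S y by move=> T [_]; apply.
have affine t : affine_hull S (x + t *: (x - y)).
  move=> T [affT ST]; have := affT x y (1 + t)
    (Ax _ (conj affT ST)) (Ay _ (conj affT ST)).
  by rewrite opprD addNKr scaleNr scalerDl scale1r scalerBr addrA.
have cont : (fun t : R => x + t *: (x - y)) @ 0 --> x.
  rewrite -[X in _ --> X]addr0; apply: cvgD; first exact: cvg_cst.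
  by rewrite -(scale0r (x - y)); apply: cvgZr_tmp; exact: cvg_id.
have /cont : nbhs x [set z | affine_hull S z -> S z] by exact: Sx.
rewrite nbhs_filterE => /nbhs_ballP[e /= e0 he].
exists (e / 2); first by rewrite divr_gt0.
apply: he => //; rewrite /ball /= sub0r normrN gtr0_norm ?divr_gt0//.
by rewrite ltr_pdivrMr// ltr_pMr// ltr1n.
Qed.

Lemma ri_sub S : ri S `<=` S.
Proof. by move=> x [Ax]; move/nbhs_singleton; apply. Qed.

Lemma convex_average S (m : nat) (f : 'I_m.+1 -> 'rV[R]_n) :
  convex_set (S : set (convex_lmodType 'rV[R]_n)) -> (forall i, S (f i)) ->
  S (m.+1%:R^-1 *: \sum_i f i).
Proof.
move=> /convex_rVP cS; elim: m f => [|m IH] f Sf.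
  by rewrite big_ord1 invr1 scale1r.
rewrite big_ord_recl.
have := cS _ _ (m.+2%:R^-1) (Sf ord0)
  (IH (fun i => f (lift ord0 i)) (fun i => Sf _)).
rewrite invr_ge0 ler0n => /(_ isT); rewrite invf_le1 ?ltr0n// ler1n => /(_ isT).
rewrite scalerA scalerDr; congr (S (_ + _ *: _)).
have h : m.+2%:R = 1 + m.+1%:R :> R by rewrite -natr1 addrC.
by rewrite h; field; rewrite nat1r nat1r !pnatr_eq0.
Qed.

(** In finite dimension the algebraic core of a convex set is relatively open: finitely many
    spanning directions can be followed both ways for a common length [t], and a nearby point of the
    affine hull is an average of such displacements. *)
Lemma core_ri S a : convex_set (S : set (convex_lmodType 'rV[R]_n)) -> S a ->
  (forall x, S x -> exists2 t : R, 0 < t & S (a + t *: (a - x))) -> ri S a.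
Proof.
move=> cS Sa core; have cS' := (convex_rVP S).1 cS.
split; first by move=> T [_]; apply.
have [m [B [SB Bs]]] := spanning_rows [set x - a | x in S].
have aff x : affine_hull S x -> (x - a <= B)%MS.
  move/(_ [set x | (x - a <= B)%MS]); apply; split=> [u v t /= ua va|y Sy /=].
    rewrite (_ : _ - a = t *: (u - a) + (1 - t) *: (v - a)); last first.
      by apply/rowP => i; rewrite !mxE; ring.
    by rewrite addmx_sub ?scalemx_sub.
  by apply: Bs; exists y.
have inS i : exists2 t : R, 0 < t & forall s, `|s| <= t -> S (a + s *: row i B).
  have [y Sy yB] := SB i; rewrite -yB; have [t t0 Sat] := core y Sy.
  exists (Num.min t 1); first by rewrite lt_min t0 ltr01.
  move=> s; rewrite le_min => /andP[st s1].
  have [s0|s0] := leP 0 s.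
    rewrite ger0_norm// in s1; have := cS' y a s Sy Sa s0 s1.
    by congr S; apply/rowP => j; rewrite !mxE; ring.
  rewrite ltr0_norm// in st.
  have r0 : 0 <= - s / t by rewrite divr_ge0 ?oppr_ge0 ?ltW.
  have r1 : - s / t <= 1 by rewrite ler_pdivrMr// mul1r.
  have := cS' _ a _ Sat Sa r0 r1; congr S.
  by apply/rowP => j; rewrite !mxE; field; rewrite gt_eqF.
have {inS} [t t0 inS] : exists2 t : R, 0 < t &
    forall i s, `|s| <= t -> S (a + s *: row i B).
  have /choice[f hf] i : exists t : R,
      0 < t /\ forall s, `|s| <= t -> S (a + s *: row i B).
    by have [t] := inS i; exists t.
  exists (\big[Num.min/1]_i f i).
    elim/big_ind: _ => // [x y x0 y0|i _]; last by have [] := hf i.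
    by rewrite lt_min x0.
  move=> i s si; apply: (hf i).2; apply: (le_trans si); exact: bigmin_le.
(* With no rows the affine hull is the single point [a]; the average below needs at least one
   row. *)
case: m B SB Bs aff inS => [|m] B SB Bs aff inS.
  rewrite /within /=; near=> x => /aff;
    rewrite (flatmx0 B) => /submx0null/subr0_eq ->.
  exact: Sa.
pose c x := (x - a) *m pinvmx B.
suff /= near_c i : \forall x \near a, `|c x 0 i| <= t / m.+1%:R.
  rewrite /within /=.
  near=> x => /aff xB.
  have cx i : `|c x 0 i| <= t / m.+1%:R.
    by move: i; near: x; apply: filter_forall => /= i; exact: near_c.
  (* Each averaged point moves along a single row, by [m.+1] times the coordinate of [x - a]; this
     is why the coordinates are required to be at most [t / m.+1]. *)
  rewrite (_ : x = m.+1%:R^-1 *: \sum_i (a + (m.+1%:R * c x 0 i) *: row i B)).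
    apply: convex_average => // i; apply: inS.
    by rewrite normrM ger0_norm// mulrC -ler_pdivlMr ?ltr0n.
  rewrite big_split/= sumr_const card_ord scalerDr -[a *+ _]scaler_nat scalerA
    mulVf ?pnatr_eq0// scale1r.
  under eq_bigr do rewrite -scalerA.
  rewrite -scaler_sumr scalerA mulVf ?pnatr_eq0// scale1r.
  by rewrite -mulmx_sum_row mulmxKpV// addrC subrK.
have : (fun x => c x 0 i) @ a --> 0.
  have -> : 0 = c a 0 i by rewrite /c subrr mul0mx mxE.
  rewrite /c; under eq_fun do rewrite mulmxBl mxE; rewrite mulmxBl mxE.
  exact: (cvgD (@continuous_mulmx _ _ _ (pinvmx B) 0 i a) (cvg_cst _)).
move/cvgr_norm_le => /(_ (t / m.+1%:R)); rewrite normr0; apply.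
by rewrite divr_gt0// ltr0n.
Unshelve. all: by end_near. Qed.

End convex_geometry.

(** * Separation in finite dimension *)

Section separation.
Context {R : realType}.

(* One coordinate is eliminated at a time: with e its unit vector and c = p e,
   q x = inf_s (p (s e + x) - s c) is again finite and sublinear. *)
Lemma linear_minorant m (p : 'rV[R]_m -> R) :
    (forall x y, p (x + y) <= p x + p y) ->
    (forall t x, 0 <= t -> p (t *: x) = t * p x) ->
  exists l : 'cV[R]_m, forall x, (x *m l) 0 0 <= p x.
Proof.
elim: m p => [|m IH] p pD pZ.
  exists 0 => x; rewrite mulmx0 mxE (thinmx0 x).
  by rewrite -[X in p X](scale0r 0) pZ// mul0r.
move: p pD pZ; rewrite -[m.+1]/(1 + m)%N => p pD pZ.
have p0 : p 0 = 0 by rewrite -[X in p X](scale0r 0) pZ// mul0r.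
pose e : 'rV[R]_(1 + m) := row_mx 1%:M 0; pose c := p e.
pose h x s := p (s *: e + row_mx 0 x) - s * c.
pose q x := inf [set h x s | s in [set: R]].
have ce s : s * c <= p (s *: e).
  have [s0|s0] := leP 0 s; first by rewrite pZ.
  rewrite -subr_ge0 /c -mulNr -(pZ _ e) ?oppr_ge0 ?(ltW s0)//.
  by apply: (le_trans _ (pD _ _)); rewrite scaleNr subrr p0.
have h_lb x s : - p (row_mx 0 (- x)) <= h x s.
  rewrite /h lerBrDr addrC -lerBrDr opprK; apply: (le_trans (ce s)).
  apply: (le_trans _ (pD _ _)).
  by rewrite -addrA add_row_mx addr0 subrr row_mx0 addr0.
have lbq x s : q x <= h x s.
  by apply: ge_inf; [exists (- p (row_mx 0 (- x))) => _ [t _ <-]|exists s].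
have qlb x y : (forall s, y <= h x s) -> y <= q x.
  move=> hy; apply: lb_le_inf; first by exists (h x 0), 0.
  by move=> _ [t _ <-].
have qD x y : q (x + y) <= q x + q y.
  rewrite -lerBlDr; apply: (qlb) => s; rewrite lerBlDr -lerBlDl.
  apply: (qlb) => t; rewrite lerBlDr; apply: (le_trans (lbq _ (t + s))).
  rewrite /h addrACA -opprD -mulrDl lerB//; apply: (le_trans _ (pD _ _)).
  by rewrite addrACA -scalerDl add_row_mx addr0 [y + x]addrC.
have qZle t x : 0 < t -> q (t *: x) <= t * q x.
  move=> t0; rewrite -ler_pdivrMl//; apply: (qlb) => s; rewrite ler_pdivrMl//.
  apply: (le_trans (lbq _ (t * s))).
  rewrite /h mulrBr mulrA -(pZ t (_ + _)) ?(ltW t0)// lerD2r.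
  by rewrite scalerDr scalerA [t *: row_mx 0 _]scale_row_mx scaler0.
have qZ t x : 0 <= t -> q (t *: x) = t * q x.
  rewrite le_eqVlt => /predU1P[<-|t0].
    rewrite scale0r mul0r; apply/eqP; rewrite eq_le; apply/andP; split.
      by apply: (le_trans (lbq _ 0));
        rewrite /h scale0r add0r row_mx0 p0 mul0r subrr.
    by apply: (qlb) => s; rewrite /h row_mx0 addr0 subr_ge0.
  apply/eqP; rewrite eq_le qZle//= -ler_pdivlMl//.
  by apply: (le_trans _ (qZle _ _ _));
    rewrite ?invr_gt0// scalerA mulVf ?gt_eqF// scale1r.
have [l hl] := IH q qD qZ.
exists (col_mx c%:M l) => x.
rewrite -(hsubmxK x) mul_row_col [lsubmx x]mx11_scalar -scalar_mxM mxE
  [_%:M _ _]mxE eqxx mulr1n.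
set s := lsubmx x 0 0; rewrite addrC -lerBrDr.
apply: (le_trans (hl _)); apply: (le_trans (lbq _ s)).
by rewrite /h lerD2r scale_row_mx scaler0 add_row_mx addr0 add0r
  scale_scalar_mx mulr1.
Qed.

Context {n : nat}.
Implicit Types (x y z a d : 'rV[R]_n) (C D F K S : set 'rV[R]_n).

(** [K] may have empty interior, so the argument runs inside its span, in coordinates with respect
    to rows taken from [K]. A linear minorant of a gauge, with its sign reversed, is the
    functional. *)
Lemma cone_separation K : K !=set0 ->
    (forall x y, K x -> K y -> K (x + y)) ->
    (forall t x, 0 < t -> K x -> K (t *: x)) -> ~ K 0 ->
  exists l : 'cV[R]_n, (forall x, K x -> 0 <= (x *m l) 0 0) /\
    exists2 x, K x & 0 < (x *m l) 0 0.
Proof.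
move=> [k0 Kk0] KD KZ K0.
have [m [B [KB Bs]]] := spanning_rows K.
have sumK (w : 'I_m -> R) : (forall i, 0 < w i) -> K (\sum_i w i *: row i B).
  move=> w0.
  have Kw i : K (w i *: row i B) by exact: (KZ).
  case: m B Bs w w0 Kw {KB} => [|m] B Bs w w0 Kw.
    exfalso; apply: K0; have := Bs _ Kk0;
      rewrite (flatmx0 B) => /submx0null k00.
    by rewrite -k00.
  rewrite big_ord_recl.
  have : forall s : seq 'I_m, K (w ord0 *: row ord0 B +
      \sum_(i <- s) w (lift ord0 i) *: row (lift ord0 i) B).
    elim=> [|i s IH]; first by rewrite big_nil addr0.
    by rewrite big_cons addrCA; exact: (KD).
  exact.
pose d := \sum_i row i B.
have Kd : K d.
  rewrite /d (eq_bigr (fun i => 1 *: row i B)) => [|i _];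
    last by rewrite scale1r.
  exact: (sumK).
(* d is an internal point of K relative to its span, so the functional
   p c = inf {s | s d - c B \in K} is finite on coordinate vectors c. *)
have mulB (c : 'rV[R]_m) : c *m B = \sum_i c 0 i *: row i B.
  by rewrite mulmx_sum_row.
have absorb (c : 'rV[R]_m) : exists s, K (s *: d - c *m B).
  exists (1 + \sum_i `|c 0 i|); rewrite mulB /d scaler_sumr -sumrB.
  under eq_bigr do rewrite -scalerBl.
  apply: (sumK) => i; rewrite subr_gt0 (le_lt_trans (ler_norm _))//.
  rewrite (bigD1 i)//= addrCA ltrDl ltr_pwDl// sumr_ge0//.
pose S c := [set s | K (s *: d - c *m B)]; pose p c := inf (S c).
(* This is where [~ K 0] enters: two members of [K] whose sum is a negative multiple of [d] would
   give [0] after adding a positive multiple of [d]. *)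
have S_lb (c : 'rV[R]_m) : exists r, lbound (S c) r.
  have [r Kr] := absorb (- c); exists (- r) => s /= Ks.
  rewrite leNgt; apply/negP => sr; apply: K0.
  have := KD _ _ Kr Ks;
    rewrite mulNmx opprK addrACA subrr addr0 -scalerDl => Krs.
  have := KD _ _ Krs (KZ (- (r + s)) _ _ Kd); rewrite -scalerDl subrr scale0r.
  by apply; lra.
have p_le c s : K (s *: d - c *m B) -> p c <= s.
  move=> Ks; apply: ge_inf => //; exact: S_lb.
have le_p (c : 'rV[R]_m) (y : R) : (forall s, S c s -> y <= s) -> y <= p c.
  by move=> hy; apply: lb_le_inf => //; exact: absorb.
have pD (x y : 'rV[R]_m) : p (x + y) <= p x + p y.
  rewrite -lerBlDr; apply: (le_p) => s Ss; rewrite lerBlDr -lerBlDl.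
  apply: (le_p) => t St; rewrite lerBlDr; apply: (p_le).
  by rewrite scalerDl mulmxDl [x *m B + _]addrC opprD addrACA; exact: (KD).
have pZle t (x : 'rV[R]_m) : 0 < t -> p (t *: x) <= t * p x.
  move=> t0; rewrite -ler_pdivrMl//; apply: (le_p) => s Ss;
    rewrite ler_pdivrMl//.
  by apply: (p_le); rewrite -scalerA -scalemxAl -scalerBr; exact: (KZ).
have p0 : p 0 = 0.
  apply/eqP; rewrite eq_le; apply/andP; split.
    apply/ler_addgt0Pr => e e0; rewrite add0r; apply: (p_le).
    by rewrite mul0mx subr0; exact: (KZ).
  apply: (le_p) => s; rewrite /S/= mul0mx subr0 => Ks.
  rewrite leNgt; apply/negP => s0; apply: K0.
  rewrite -(scale0r d) -(subrr s) scalerBl -scaleNr; apply: (KD) => //.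
  by apply: (KZ); rewrite ?oppr_gt0.
have pZ t (x : 'rV[R]_m) : 0 <= t -> p (t *: x) = t * p x.
  rewrite le_eqVlt => /predU1P[<-|t0]; first by rewrite scale0r mul0r.
  apply/eqP; rewrite eq_le pZle//= -ler_pdivlMl//.
  by apply: (le_trans _ (pZle _ _ _));
    rewrite ?invr_gt0// scalerA mulVf ?gt_eqF// scale1r.
have [l hl] := linear_minorant pD pZ.
have Kl x : K x -> - ((x *m (pinvmx B *m l)) 0 0) <= p (- (x *m pinvmx B)).
  by move=> Kx; apply: (le_trans _ (hl _)); rewrite mulNmx [leRHS]mxE mulmxA.
have pK x s : K x -> K (s *: d + x) -> p (- (x *m pinvmx B)) <= s.
  by move=> Kx Ks; apply: (p_le); rewrite mulNmx opprK mulmxKpV//; exact: Bs.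
exists (pinvmx B *m l); split=> [x Kx|].
  rewrite -oppr_le0; apply: (le_trans (Kl _ Kx)); apply: (pK) => //.
  by rewrite scale0r add0r.
exists d => //; rewrite -oppr_lt0; apply: (le_lt_trans (Kl _ Kd)).
(* Since [d - d/2 = d/2] is still in [K], the gauge at the coordinates of [- d] is at most [- 1/2];
   this makes the separation strict at [d]. *)
apply: (@le_lt_trans _ _ (- 2^-1)); last by rewrite oppr_lt0 invr_gt0.
apply: (pK) => //; rewrite -[X in _ + X]scale1r -scalerDl.
by apply: (KZ) => //; lra.
Qed.

(** The cone generated by [D - a] misses [0] because [a] is not in [D], so separating it from [0]
    suffices. *)
Lemma convex_separation D a :
    convex_set (D : set (convex_lmodType 'rV[R]_n)) -> D !=set0 -> ~ D a ->
  exists l : 'cV[R]_n, (forall d, D d -> (a *m l) 0 0 <= (d *m l) 0 0) /\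
    exists2 d, D d & (a *m l) 0 0 < (d *m l) 0 0.
Proof.
move=> /convex_rVP cD [d0 Dd0] Da.
pose K := [set x | exists t d, [/\ 0 < t, D d & x = t *: (d - a)]].
have /cone_separation : K !=set0 by exists (1 *: (d0 - a)), 1, d0.
have KD x y : K x -> K y -> K (x + y).
  move=> [t [d [t0 Dd ->]]] [s [b [s0 Db ->]]].
  have ts : 0 < t + s by rewrite addr_gt0.
  exists (t + s), (t / (t + s) *: d + (1 - t / (t + s)) *: b); split=> //.
    apply: (cD) => //; first by rewrite divr_ge0// ltW.
    by rewrite ler_pdivrMr// mul1r lerDl ltW.
  by apply/rowP => i; rewrite !mxE; field; rewrite gt_eqF.
have KZ t x : 0 < t -> K x -> K (t *: x).
  move=> t0 [s [d [s0 Dd ->]]]; exists (t * s), d; split=> //;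
    first exact: mulr_gt0.
  by rewrite scalerA.
have K0 : ~ K 0.
  move=> [t [d [t0 Dd /esym/eqP]]];
    rewrite scaler_eq0 gt_eqF//= subr_eq0 => /eqP da.
  by apply: Da; rewrite -da.
move=> /(_ KD KZ K0)[l [lK [_ [t [d [t0 Dd ->]]] hd]]].
exists l; split=> [b Db|].
  have /lK : K (b - a) by exists 1, b; rewrite scale1r.
  by rewrite mulmxBl mxE [X in _ + X]mxE subr_ge0.
exists d => //; move: hd.
by rewrite -scalemxAl mxE pmulr_rgt0// mulmxBl mxE [X in _ + X]mxE subr_gt0.
Qed.

End separation.

(** * Faces of convex cones *)

Section faces.
Context {R : realType} {n : nat}.
Implicit Types (x y z a : 'rV[R]_n) (C D F K S : set 'rV[R]_n).

Lemma ri_segment x y (t : R) : 0 < t < 1 ->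
  ri (segment x y) (t *: x + (1 - t) *: y).
Proof.
move=> /andP[t0 t1]; apply: core_ri.
- apply/convex_rVP => _ _ s [u /= /andP[u0 u1] <-] [v /= /andP[v0 v1] <-] s0 s1.
  exists (s * u + (1 - s) * v) => /=.
    by apply/andP; split; nra.
  by apply/rowP => i; rewrite !mxE; ring.
- by exists t => //=; rewrite !ltW.
- move=> _ [u /= /andP[u0 u1] <-].
  (* The distance from [t] to the nearer endpoint; as [|t - u| <= 1], the parameter
     [t + e * (t - u)] stays in [[0, 1]]. *)
  pose e := Num.min t (1 - t).
  have e0 : 0 < e by rewrite lt_min t0 subr_gt0.
  have et : e <= t by rewrite ge_min lexx.
  have et1 : e <= 1 - t by rewrite ge_min lexx orbT.
  exists e => //; exists (t + e * (t - u)) => /=.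
    by apply/andP; split; nra.
  by apply/rowP => i; rewrite !mxE; ring.
Qed.

Definition convex_cone C :=
  [/\ C 0, forall x y, C x -> C y -> C (x + y) &
      forall (t : R) x, 0 <= t -> C x -> C (t *: x)].

Section face_of_cone.
Variables (C F : set 'rV[R]_n) (coneC : convex_cone C) (faceF : face C F).

Lemma segment_sub_cone x y : C x -> C y -> segment x y `<=` C.
Proof.
have [_ CD CZ] := coneC => Cx Cy _ [t /= /andP[t0 t1] <-].
by apply: CD; apply: CZ => //; rewrite subr_ge0.
Qed.

Lemma face_mid x y (t : R) : C x -> C y -> 0 < t < 1 ->
  F (t *: x + (1 - t) *: y) -> F x /\ F y.
Proof.
have [_ _ _ Fseg] := faceF => Cx Cy t01 Ft.
have sub : segment x y `<=` F.
  apply: Fseg; first exact: segment_sub_cone.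
  by exists (t *: x + (1 - t) *: y); split=> //; exact: ri_segment.
split; apply: sub.
  by exists 1 => /=; [rewrite ler01 lexx|rewrite subrr scale0r scale1r addr0].
by exists 0 => /=; [rewrite ler01 lexx|rewrite subr0 scale0r scale1r add0r].
Qed.

(** For [s > 1] the point [x] lies strictly between [0] and [s *: x], so a face through [x] contains
    both ends. *)
Lemma face_convex_cone : convex_cone F.
Proof.
have [C0 CD CZ] := coneC; have [[x0 Fx0] /convex_rVP cF FC _] := faceF.
have big s x : 1 < s -> F x -> F 0 /\ F (s *: x).
  move=> s1 Fx; have s0 : 0 < s by apply: lt_trans s1.
  have [||||] := @face_mid (s *: x) 0 s^-1 => //.
  - by apply: CZ; [exact: ltW|exact: FC].
  - by rewrite invr_gt0 s0 invf_lt1.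
  - by rewrite scaler0 addr0 scalerA mulVf ?gt_eqF// scale1r.
have F0 : F 0 by have [] := big 2 x0 (ltr1n _ _) Fx0.
have FZ t x : 0 <= t -> F x -> F (t *: x).
  move=> t0 Fx; have [t1|t1] := leP t 1.
    by have := cF _ _ _ Fx F0 t0 t1; rewrite scaler0 addr0.
  by have [] := big t x t1 Fx.
split=> // x y Fx Fy.
have := cF _ _ 2^-1 (FZ 2 x (ler0n _ _) Fx) (FZ 2 y (ler0n _ _) Fy).
rewrite invr_ge0 ler0n invf_le1// ler1n => /(_ isT isT); congr F.
by apply/rowP => i; rewrite !mxE; field.
Qed.

(** [x + y] is the midpoint of [2 *: x] and [2 *: y], both in [C]. *)
Lemma face_summand x y : C x -> C y -> F (x + y) -> F x.
Proof.
have [C0 CD CZ] := coneC; have [_ _ FZ] := face_convex_cone => Cx Cy Fxy.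
have [||||+ _] := @face_mid (2 *: x) (2 *: y) 2^-1.
- exact: CZ.
- exact: CZ.
- by rewrite invr_gt0 ltr0n invf_lt1// ltr1n.
- rewrite (_ : _ + _ = x + y)//.
  by apply/rowP => i; rewrite !mxE; field.
- move=> F2x; have := FZ 2^-1 _ _ F2x; rewrite invr_ge0 ler0n => /(_ isT).
  by rewrite scalerA mulVf ?scale1r// pnatr_eq0.
Qed.

(** A face is the trace on [C] of its span: adding to [x] the rows weighted by the negative parts of
    its coefficients yields a nonnegative combination of rows, which lies in [F], and [x] is a
    summand of it. *)
Lemma face_row_span m (B : 'M[R]_(m, n)) x :
  (forall i, F (row i B)) -> C x -> (x <= B)%MS -> F x.
Proof.
have [C0 CD CZ] := coneC; have [F0 FD FZ] := face_convex_cone.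
have [_ _ FC _] := faceF.
move=> FB Cx /submxP[w xw].
have Fsum (v : 'I_m -> R) : (forall i, 0 <= v i) -> F (\sum_i v i *: row i B).
  move=> v0; elim/big_rec: _ => // i y _ Fy; apply: FD => //.
  exact: FZ.
apply: (@face_summand x (\sum_i Num.max 0 (- w 0 i) *: row i B)) => //.
  by apply/FC/Fsum => i; rewrite le_max lexx.
rewrite xw mulmx_sum_row -big_split/=.
under eq_bigr do rewrite -scalerDl.
apply: Fsum => i; rewrite maxEle oppr_ge0.
by case: (leP (w 0 i) 0) => [_|/ltW]; rewrite ?subrr ?addr0 ?lexx.
Qed.

End face_of_cone.

Lemma convex_cone_convex C : convex_cone C ->
  convex_set (C : set (convex_lmodType 'rV[R]_n)).
Proof.
move=> [C0 CD CZ]; apply/convex_rVP => x y t Cx Cy t0 t1.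
by apply: CD; apply: CZ => //; rewrite subr_ge0.
Qed.

(** The witness is the minimal face of [a]: the points of [C] of which a positive multiple can be
    subtracted from [a] without leaving [C]. *)
Lemma face_of_point C a : convex_cone C -> C a -> exists2 F, face C F & ri F a.
Proof.
move=> coneC Ca; have [C0 CD CZ] := coneC.
pose F := [set x | C x /\ exists2 t : R, 0 < t & C (a - t *: x)].
have Fa : F a by split=> //; exists 1 => //; rewrite scale1r subrr.
have shrink s t x : 0 <= s -> s <= t -> C x -> C (a - t *: x) -> C (a - s *: x).
  move=> s0 st Cx Ct; rewrite (_ : _ - _ = (a - t *: x) + (t - s) *: x).
    by apply: CD => //; apply: CZ => //; rewrite subr_ge0.
  by apply/rowP => i; rewrite !mxE; ring.
have coneF : convex_cone F.
  split=> [|x y [Cx [t t0 Ct]] [Cy [s s0 Cs]]|t x t0 [Cx [s s0 Cs]]].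
  - by split=> //; exists 1 => //; rewrite scaler0 subr0.
  - split; first exact: CD.
    exists (Num.min t s / 2); first by rewrite divr_gt0// lt_min t0.
    have m0 : 0 <= Num.min t s by rewrite le_min !ltW.
    have mt : C (a - Num.min t s *: x).
      by apply: (shrink _ t) => //; rewrite ge_min lexx.
    have ms : C (a - Num.min t s *: y).
      by apply: (shrink _ s) => //; rewrite ge_min lexx orbT.
    rewrite (_ : _ - _ = 2^-1 *: (a - Num.min t s *: x) +
                         2^-1 *: (a - Num.min t s *: y)).
      by apply: CD; apply: CZ.
    by apply/rowP => i; rewrite !mxE; field.
  - split; first exact: CZ.
    exists (s / (t + 1)); first by rewrite divr_gt0// ltr_wpDl.
    have t1 : 0 < t + 1 by rewrite ltr_wpDl.
    rewrite scalerA; apply: shrink Cs => //.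
      by rewrite mulr_ge0// divr_ge0 ?(ltW s0) ?(ltW t1).
    by rewrite mulrAC ler_pdivrMr// ler_pM2l// lerDl.
exists F; last first.
  apply: core_ri => //; first exact: convex_cone_convex.
  move=> x [Cx [t t0 Ct]]; exists (Num.min t 1 / 2).
    by rewrite divr_gt0// lt_min t0 ltr01.
  pose r := Num.min t 1 / 2.
  have r0 : 0 < r by rewrite divr_gt0// lt_min t0 ltr01.
  have rt : r <= t by rewrite ler_pdivrMr// ge_min; apply/orP; left; lra.
  have r1 : r < 1 by rewrite ltr_pdivrMr// mul1r (le_lt_trans (_ : _ <= 1))//
    ?ge_min ?lexx ?orbT// ltr1n.
  rewrite -/r; split.
    rewrite (_ : _ + _ = r *: a + (a - r *: x)).
      by apply: CD; [apply: CZ => //; exact: ltW|apply: shrink Ct => //;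
        exact: ltW].
    by apply/rowP => i; rewrite !mxE; ring.
  exists 2^-1; first by rewrite invr_gt0.
  rewrite (_ : _ - _ = ((1 - r) / 2) *: a + (r / 2) *: x).
    by apply: CD; apply: CZ => //; rewrite divr_ge0// ?subr_ge0 ltW.
  by apply/rowP => i; rewrite !mxE; field.
split.
- by exists a.
- exact: convex_cone_convex.
- by move=> x [].
- move=> x y segC [p [ri_p [Cp [s s0 Cs]]]] u seg_u; split; first exact: segC.
  have [t t0 /segC Ct] := ri_core ri_p seg_u.
  have t1 : 0 < 1 + t by rewrite addr_gt0.
  (* The coefficient is chosen so that the multiple [s / (1 + t)] of the prolonged point
     [p + t *: (p - u)] restores exactly the [s *: p] removed from [a]. *)
  exists (s * t / (1 + t)); first by rewrite divr_gt0// mulr_gt0.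
  rewrite (_ : _ - _ = (a - s *: p) + (s / (1 + t)) *: (p + t *: (p - u))).
    by apply: CD => //; apply: CZ => //; rewrite divr_ge0 ?(ltW s0) ?(ltW t1).
  by apply/rowP => i; rewrite !mxE; field; rewrite gt_eqF.
Qed.

End faces.

(** * Convex integrands *)

Section classGamma_theory.
Context {R : realType}.
Variables (gam : R -> \bar R) (Ggam : classGamma gam).

Let f t := fine (gam t).

Lemma classGammaE t : 0 < t -> gam t = (fine (gam t))%:E.
Proof. by have [_ gfin _ _ _] := Ggam => t0; rewrite fineK// gfin. Qed.

Lemma classGamma_convex s t l : 0 < s -> 0 < t -> s != t -> 0 < l < 1 ->
  f (l * s + (1 - l) * t) < l * f s + (1 - l) * f t.
Proof.
have [_ _ gc _ _] := Ggam => s0 t0 st l01.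
have := gc s t l s0 t0 st l01; have /andP[l0 l1] := l01.
rewrite (classGammaE s0) (classGammaE t0) classGammaE ?lte_fin//.
by rewrite addr_gt0// mulr_gt0// subr_gt0.
Qed.

(** The three-chord inequality with denominators cleared, so that its consequences reduce to linear
    arithmetic. *)
Lemma classGamma_chord r s t : 0 < r -> r < s -> s < t ->
  (t - r) * f s < (t - s) * f r + (s - r) * f t.
Proof.
move=> r0 rs st; have rt : 0 < t - r by lra.
have l01 : 0 < (t - s) / (t - r) < 1.
  apply/andP; split; first by rewrite divr_gt0// subr_gt0.
  by rewrite ltr_pdivrMr// mul1r; lra.
have t0 : 0 < t by lra.
have rneqt : r != t by rewrite lt_eqF//; lra.
have := classGamma_convex r0 t0 rneqt l01.
have -> : (t - s) / (t - r) * r + (1 - (t - s) / (t - r)) * t = s.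
  by field; rewrite gt_eqF.
rewrite -(ltr_pM2l rt) => /lt_le_trans; apply.
by rewrite le_eqVlt; apply/orP; left; apply/eqP; field; rewrite gt_eqF.
Qed.

Lemma classGamma_right_continuous t : 0 <= t -> gam s @[s --> t^'+] --> gam t.
Proof.
rewrite le_eqVlt => /predU1P[<-|t0]; first by have [] := Ggam.
rewrite (classGammaE t0); apply/fine_cvgP; split.
  near=> s; rewrite classGammaE//; rewrite (lt_trans t0)//; near: s;
    exact: nbhs_right_gt.
(* For [s] in []t, 2 * t[] the slope of [f] from [t] to [s] lies between its slopes over
   [[t / 2, t]] and [[t, 2 * t]]; [K] adds their absolute values. The factor 2 comes from the
   half-length interval. *)
pose K := (`|f (2 * t) - f t| + 2 * `|f t - f (t / 2)|) / t.
have K0 : 0 <= K by rewrite divr_ge0 ?(ltW t0)// addr_ge0// mulr_ge0.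
have lip s : t < s -> s < 2 * t -> `|f t - f s| <= K * (s - t).
  move=> ts s2; rewrite /K mulrAC ler_pdivlMr//.
  have up := classGamma_chord t0 ts s2.
  have th : 0 < t / 2 by lra.
  have ht : t / 2 < t by lra.
  have lo := classGamma_chord th ht ts.
  have a1 := ler_norm (f (2 * t) - f t).
  have st0 : 0 <= s - t by lra.
  have b1 := ler_wpM2l st0 a1.
  have b2 : (s - t) * (f (t / 2) - f t) <= (s - t) * `|f t - f (t / 2)|.
    by rewrite ler_wpM2l// distrC ler_norm.
  have b3 : 0 <= (s - t) * `|f (2 * t) - f t| by rewrite mulr_ge0.
  have b4 : 0 <= (s - t) * `|f t - f (t / 2)| by rewrite mulr_ge0.
  rewrite -{2}(gtr0_norm t0) -normrM ler_norml.
  move: b1 b2 b3 b4 up lo; clear.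
  set A := `|_|; set B := `|_|; set x := f s; set y := f t; set z := f (2 * t);
    set w := f (t / 2).
  move=> *; apply/andP; split; lra.
apply/cvgrPdist_le => e e0; near=> s; rewrite /= -/(f s) -/(f t).
apply: (le_trans (lip s _ _)); first by near: s; exact: nbhs_right_gt.
  by near: s; apply: nbhs_right_lt; lra.
have : s < t + e / (K + 1).
  by near: s; apply: nbhs_right_lt; rewrite ltrDl divr_gt0// ltr_wpDl.
rewrite -ltrBlDl ltr_pdivlMr ?ltr_wpDl// => h.
have ts : t < s by near: s; exact: nbhs_right_gt.
apply: le_trans (ltW h); rewrite [leRHS]mulrDr mulr1 mulrC lerDl; lra.
Unshelve. all: by end_near. Qed.

(** This weak form of convexity suffices later and avoids arithmetic with an infinite value at [0].
    The case [r = 0] follows by letting a positive left endpoint tend to [0]. *)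
Lemma classGamma_quasiconvex r s t : 0 <= r -> r <= s -> s <= t ->
  (gam s <= maxe (gam r) (gam t))%E.
Proof.
move=> r0 rs st.
have pos u : 0 < u -> u < s -> (gam s <= maxe (gam u) (gam t))%E.
  move=> u0 us; have [->|ne] := eqVneq s t; first by rewrite le_max lexx orbT.
  have {}st : s < t by rewrite lt_neqAle ne.
  have := classGamma_chord u0 us st.
  rewrite (classGammaE u0) (@classGammaE s); last by lra.
  rewrite (@classGammaE t); last by lra.
  rewrite -EFin_max lee_fin -/(f s) -/(f u) -/(f t) => h.
  rewrite leNgt; apply/negP; rewrite gt_max => /andP[h1 h2].
  have b1 : (t - s) * f u <= (t - s) * f s by rewrite ler_wpM2l ?(ltW h1) ?(ltW h2)//
    subr_ge0 ltW.
  have b2 : (s - u) * f t <= (s - u) * f s by rewrite ler_wpM2l ?(ltW h1) ?(ltW h2)//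
    subr_ge0 ltW.
  lra.
move: rs; rewrite le_eqVlt => /predU1P[<-|rs]; first by rewrite le_max lexx.
move: r0; rewrite le_eqVlt => /predU1P[r0|r0]; last exact: pos.
rewrite -{}r0 in rs *.
have [gst|gst] := leP (gam s) (gam t); first by rewrite le_max gst orbT.
rewrite le_max; apply/orP; left.
have [_ _ _ _ g0] := Ggam; apply: (cvge_ge _ g0).
near=> u; have := pos u; rewrite le_max [X in _ || X]leNgt gst orbF; apply.
  by near: u; exact: nbhs_right_gt.
by near: u; exact: nbhs_right_lt.
Unshelve. all: by end_near. Qed.

End classGamma_theory.

(* beta z is only right-continuous at 0, so g is discretized from above. *)
Lemma measurable_classB d (Z : measurableType d) (R : realType)
    (beta : Z -> R -> \bar R) (g : Z -> R) : classB beta ->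
  measurable_fun [set: Z] g -> (forall z, 0 <= g z) ->
  measurable_fun [set: Z] (fun z => beta z (g z)).
Proof.
move=> [mbeta Gbeta] mg g0.
(* The least multiple of [1 / k.+1] strictly above [g z]. Strictness is needed because right limits
   exclude the point itself; countably many values make [beta z (q k z)] measurable piece by
   piece. *)
pose q k z : R := (Num.truncn (k.+1%:R * g z)).+1%:R / k.+1%:R.
have qP k z : g z < q k z <= g z + k.+1%:R^-1.
  have /andP[h1 h2] : (Num.truncn (k.+1%:R * g z))%:R <= k.+1%:R * g z <
    (Num.truncn (k.+1%:R * g z)).+1%:R.
    by apply: truncn_itv; rewrite mulr_ge0.
  rewrite /q ltr_pdivlMr ?ltr0n// mulrC h2/= ler_pdivrMr ?ltr0n//
    mulrDl mulVf ?pnatr_eq0//.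
  by rewrite -[(Num.truncn _).+1%:R]natr1 lerD2r [leRHS]mulrC.
apply: (@emeasurable_fun_cvg _ _ _ _ (fun k z => beta z (q k z))) => [k|z _].
  move=> _ B mB; rewrite setTI.
  have -> : (fun z => beta z (q k z)) @^-1` B = \bigcup_j
      ([set z | j%:R <= k.+1%:R * g z < j.+1%:R] `&`
       ((beta ^~ (j.+1%:R / k.+1%:R)) @^-1` B)).
    apply/seteqP; split=> z /=.
      move=> Bz; exists (Num.truncn (k.+1%:R * g z)) => //; split=> //=.
      by apply: truncn_itv; rewrite mulr_ge0.
    by move=> [j _ [/= /truncn_def jz Bz]]; rewrite /q jz.
  apply: bigcup_measurable => j _; apply: measurableI; last first.
    by rewrite -[X in measurable X]setTI; exact: mbeta.
  rewrite (_ : [set z | _] = [set: Z] `&` (fun z => k.+1%:R * g z) @^-1`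
    `[j%:R, j.+1%:R[); last first.
    by rewrite setTI; apply/seteqP; split=> z /=; rewrite in_itv.
  have mk : measurable_fun [set: Z] (fun z => k.+1%:R * g z) by exact:
    measurable_funM.
  exact: mk.
apply: cvg_comp (classGamma_right_continuous (Gbeta z) (g0 z)).
have qg : q ^~ z @ \oo --> g z.
  have qh : g z + k.+1%:R^-1 @[k --> \oo] --> g z.
    rewrite -[X in _ --> X]addr0; apply: cvgD; first exact: cvg_cst.
    exact: cvg_harmonic.
  apply: (squeeze_cvgr _ (cvg_cst (g z)) qh).
  by near=> k; have /andP[/ltW -> ->] := qP k z.
move=> P /qg Pq; apply: (@filterS _ \oo _ (fun k => g z < q k z -> P (q k z)));
  last exact: Pq.
by move=> k; apply; have /andP[] := qP k z.
Unshelve. all: by end_near. Qed.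

(** * Moments *)

(** The convention sends the undefined case to [+oo], so an infinite positive part always gives
    [+oo]. From here on only positive parts of [beta] have to be controlled. *)
Lemma cintegral_lty d (T : measurableType d) (R : realType)
    (mu : {measure set T -> \bar R}) (D : set T) (f : T -> \bar R) :
  (cintegral mu D f < +oo)%E <-> (\int[mu]_(x in D) (f^\+ x) < +oo)%E.
Proof.
rewrite /cintegral (integralE _ _ f).
have p0 : (0 <= \int[mu]_(x in D) f^\+ x)%E by exact: integral_ge0.
have n0 : (0 <= \int[mu]_(x in D) f^\- x)%E by exact: integral_ge0.
move: p0 n0; set P := (\int[mu]_(x in D) f^\+ x)%E.
set N := (\int[mu]_(x in D) f^\- x)%E.
by case: P => [p| |]//; case: N => [m| |]//= _ _; rewrite ?ltry ?ltNyr ?ltxx.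
Qed.

Lemma sigma_finite_integrable_gt0 d (T : measurableType d) (R : realType)
    (mu : {sigma_finite_measure set T -> \bar R}) :
  exists u : T -> R, [/\ measurable_fun [set: T] u, forall x, 0 < u x &
    mu.-integrable [set: T] (EFin \o u)].
Proof.
have [A TA mA] := sigma_finiteT mu.
(* Dividing by [1 + mu (A i)] bounds both the value and the integral of the [i]-th term by
   [2 ^ -(i + 1)]: the series is finite everywhere and integrable. *)
pose c i : R := (1 + fine (mu (A i)))^-1 / (2 ^ i.+1)%:R.
have m0 i : 0 <= fine (mu (A i)) by exact: fine_ge0.
have c0 i : 0 < c i.
  by rewrite divr_gt0// ?invr_gt0 ?ltr0n ?expn_gt0// ltr_pwDl.
have w0 i x : (0 <= (c i * \1_(A i) x)%:E)%E by rewrite lee_fin mulr_ge0// ltW.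
pose w x := (\sum_(i <oo) (c i * \1_(A i) x)%:E)%E.
have mci i : measurable_fun [set: T] (fun x => (c i * \1_(A i) x)%:E).
  by apply/measurable_EFinP; apply: measurable_funM => //;
    apply: measurable_indic; have [] := mA i.
have mw : measurable_fun [set: T] w by exact: ge0_emeasurable_sum.
have iw : (\int[mu]_x w x < +oo)%E.
  rewrite /w integral_nneseries//.
  apply: (@le_lt_trans _ _ (\sum_(i <oo) (1 / (2 ^ i.+1)%:R)%:E)%E); last first.
    by apply: (le_lt_trans (epsilon_trick0 _ _)); rewrite ?ltry.
  apply: lee_nneseries => [i|i _]; first by move=> *; exact: integral_ge0.
  under eq_integral do rewrite EFinM.
  have [mAi fAi] := mA i.
  rewrite ge0_integralZl_EFin//; last 2 first.
  - by apply/measurable_EFinP; exact: measurable_indic.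
  - exact: ltW.
  rewrite integral_indic// setIT -[X in (_ * X)%E]fineK; last first.
    by rewrite ge0_fin_numE.
  rewrite -EFinM lee_fin /c mulrAC ler_pM2r ?invr_gt0 ?ltr0n ?expn_gt0//.
  by rewrite mulrC ler_pdivrMr ?mul1r ?lerDr// ltr_pwDl.
have wfin x : w x \is a fin_num.
  rewrite ge0_fin_numE; last by apply: nneseries_ge0.
  apply: (@le_lt_trans _ _ (\sum_(i <oo) (1 / (2 ^ i.+1)%:R)%:E)%E); last first.
    by apply: (le_lt_trans (epsilon_trick0 _ _)); rewrite ?ltry.
  apply: lee_nneseries => // i _;
    rewrite lee_fin /c mulrAC ler_pM2r ?invr_gt0 ?ltr0n ?expn_gt0//.
  rewrite ler_pdivrMl ?ltr_pwDl// mulr1 indicE.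
  by apply: (@le_trans _ _ 1); [case: (_ \in _)|rewrite lerDl].
have wgt0 x : (0 < w x)%E.
  have [i _ Aix] : (\bigcup_i A i) x by rewrite -TA.
  apply: (@lt_le_trans _ _ (\sum_(0 <= j < i.+1) (c j * \1_(A j) x)%:E)%E);
    last first.
    exact: nneseries_lim_ge.
  rewrite big_nat_recr//= (@lt_le_trans _ _ (c i * \1_(A i) x)%:E)//.
    by rewrite lte_fin indicE mem_set// mulr1.
  by rewrite leeDr// sume_ge0.
exists (fine \o w); split.
- by apply: measurableT_comp => //; exact: fine_measurable.
- by move=> x; rewrite /= fine_gt0// wgt0/= -ge0_fin_numE ?(ltW (wgt0 x)).
- apply/integrableP; split.
    by apply/measurable_EFinP; apply: measurableT_comp => //;
      exact: fine_measurable.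
  rewrite (eq_integral w) => [|x _]; first exact: iw.
  by rewrite /comp fineK// gee0_abs// ltW.
Qed.

Section moments.
Context d (Z : measurableType d) (R : realType) (n : nat).
Variables (mu : {sigma_finite_measure set Z -> \bar R}) (phi : Z -> 'rV[R]_n).
Hypothesis mphi : borel_measurable phi.
Implicit Types (g h : Z -> R) (F : set 'rV[R]_n).

Local Notation moment := (moment mu phi).
Local Notation Gplus := (Gplus mu phi).
Local Notation Gspace := (Gspace mu phi).
Local Notation phi_cone := (phi_cone mu phi).

Lemma measurable_preimage_open U : open U -> measurable (phi @^-1` U).
Proof.
move=> oU; rewrite -[X in measurable X]setTI; apply: mphi => //.
exact: sub_sigma_algebra.
Qed.

Lemma measurable_coord i : measurable_fun [set: Z] (fun z => phi z 0 i).
Proof.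
apply: (measurability (@RGenOpens.G R)); first exact: RGenOpens.measurableE.
move=> _ [_ [a [b ->]] <-]; rewrite setTI.
apply: (@measurable_preimage_open ((fun M : 'rV[R]_n => M 0 i) @^-1` `]a, b[)).
apply: open_comp => // x _; exact: coord_continuous.
Qed.

Lemma Gspace_le g h : measurable_fun [set: Z] h -> (forall z, `|h z| <= g z) ->
  Gspace g -> Gspace h.
Proof.
move=> mh hg [mg ig]; split=> // i; apply: le_integrable (ig i) => //.
  by apply/measurable_EFinP; apply: measurable_funM => //;
    exact: measurable_coord.
move=> z _; rewrite !abse_EFin lee_fin !normrM ler_wpM2l//.
by rewrite (le_trans (hg z))// ler_norm.
Qed.

Lemma GspaceD g h : Gspace g -> Gspace h -> Gspace (g \+ h).
Proof.
move=> [mg ig] [mh ih]; split=> [|i]; first exact: measurable_funD.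
apply: eq_integrable (integrableD _ (ig i) (ih i)) => //.
by move=> z _ /=; rewrite mulrDr EFinD.
Qed.

Lemma GspaceZ (t : R) g : Gspace g -> Gspace (t \*o g).
Proof.
move=> [mg ig]; split=> [|i]; first exact: measurable_funM.
apply: eq_integrable (integrableZl _ t (ig i)) => //.
by move=> z _ /=; rewrite mulrCA EFinM.
Qed.

Lemma momentD g h : Gspace g -> Gspace h ->
  moment (g \+ h) = moment g + moment h.
Proof.
move=> [mg ig] [mh ih]; apply/rowP => i; rewrite !mxE -RintegralD//;
  [|exact: ig|exact: ih].
by apply: eq_Rintegral => z _; rewrite mulrDr.
Qed.

Lemma momentZ (t : R) g : Gspace g -> moment (t \*o g) = t *: moment g.
Proof.
move=> [mg ig]; apply/rowP => i; rewrite !mxE -RintegralZl//; last exact: ig.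
by apply: eq_Rintegral => z _; rewrite mulrCA.
Qed.

Lemma GplusD g h : Gplus g -> Gplus h -> Gplus (g \+ h).
Proof. by move=> [Gg g0] [Gh h0]; split=> [|z];
  [exact: GspaceD|rewrite addr_ge0]. Qed.

Lemma GplusZ (t : R) g : 0 <= t -> Gplus g -> Gplus (t \*o g).
Proof. by move=> t0 [Gg g0]; split=> [|z];
  [exact: GspaceZ|rewrite mulr_ge0]. Qed.

Lemma Gplus_le g h : measurable_fun [set: Z] h -> (forall z, 0 <= h z <= g z) ->
  Gplus g -> Gplus h.
Proof.
move=> mh hg [Gg g0]; split=> [|z]; last by have /andP[] := hg z.
by apply: Gspace_le Gg => // z; have /andP[h0 ?] := hg z; rewrite ger0_norm.
Qed.

Lemma convex_cone_phi_cone : convex_cone phi_cone.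
Proof.
split.
- exists (cst 0).
    split=> //; split=> // i; rewrite (_ : (fun z => _) = cst 0%E);
      first exact: integrable0.
    by apply/funext => z; rewrite mulr0.
  apply/rowP => i; rewrite !mxE /Rintegral integral0_eq// => z _.
  by rewrite mulr0.
- move=> _ _ [g Gg <-] [h Gh <-]; exists (g \+ h); first exact: GplusD.
  by rewrite momentD; [|exact: Gg.1|exact: Gh.1].
- move=> t _ t0 [g Gg <-]; exists (t \*o g); first exact: GplusZ.
  by rewrite momentZ//; exact: Gg.1.
Qed.

Lemma moment_ae_eq g h : Gspace g -> Gspace h ->
  mu.-negligible [set z | g z != h z] -> moment g = moment h.
Proof.
move=> [mg ig] [mh ih] gh; apply/rowP => i; rewrite !mxE; congr fine.
apply: ae_eq_integral => //.
- exact: (measurable_int mu).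
- exact: (measurable_int mu).
apply: negligibleS gh => z /= zgh; apply/eqP => gzhz; apply: zgh => _.
by rewrite gzhz.
Qed.

Lemma cvg_moment (f : nat -> Z -> R) g h i :
  (forall k, measurable_fun [set: Z] (f k)) -> Gspace g -> Gspace h ->
  (forall k z, `|f k z| <= h z) -> (forall z, f ^~ z @ \oo --> g z) ->
  moment (f k) 0 i @[k --> \oo] --> moment g 0 i.
Proof.
move=> mf [mg ig] [mh ih] fh fg; rewrite mxE; under eq_fun do rewrite mxE.
have mphiM (k : Z -> R) : measurable_fun [set: Z] k ->
    measurable_fun [set: Z] (fun z => (phi z 0 i * k z)%:E).
  by move=> mk; apply/measurable_EFinP; apply: measurable_funM => //;
    exact: measurable_coord.
have := @dominated_convergence _ _ _ mu _ measurableT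
  (fun k z => (phi z 0 i * f k z)%:E) (fun z => (phi z 0 i * g z)%:E)
  (abse \o (fun z => (phi z 0 i * h z)%:E)).
case=> [k|||||_ _].
- exact: mphiM.
- exact: mphiM.
- apply: aeW => z _; apply: cvg_EFin; first exact: nearW.
  by apply: cvgMl_tmp; exact: fg.
- by apply: integrable_abse => //; exact: ih.
- apply: aeW => z k _; rewrite lee_fin !normrM ler_wpM2l//.
  exact: le_trans (fh k z) (ler_norm _).
- rewrite -[X in _ --> X]fineK; first exact: fine_cvg.
  by apply: integrable_fin_num; [|exact: ig].
Qed.

Lemma moment_linear (l : 'cV[R]_n) g : Gspace g ->
  (moment g *m l) 0 0 = \int[mu]_z ((phi z *m l) 0 0 * g z).
Proof.
move=> [mg ig]; rewrite mxE.
have igl i : mu.-integrable [set: Z]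
    (fun z => (l i 0)%:E * (phi z 0 i * g z)%:E)%E.
  by apply: integrableZl => //; exact: ig.
transitivity (\sum_i \int[mu]_z (l i 0 * (phi z 0 i * g z))).
  by apply: eq_bigr => i _; rewrite mxE mulrC RintegralZl//; exact: ig.
apply: EFin_inj; rewrite -sumEFin /Rintegral.
under eq_bigr => i _ do rewrite fineK ?
  (integrable_fin_num measurableT (igl i))//.
rewrite -integral_sum// fineK; last first.
  rewrite (eq_integral (fun z => \sum_i (l i 0)%:E * (phi z 0 i * g z)%:E))%E.
    apply: integrable_fin_num => //; exact: integrable_sum.
  move=> z _; rewrite mxE mulr_suml -sumEFin; apply: eq_bigr => i _.
  by rewrite -EFinM mulrAC mulrC.
apply: eq_integral => z _; rewrite mxE mulr_suml -sumEFin;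
  apply: eq_bigr => i _.
by rewrite mulrCA mulrA.
Qed.


End moments.

(** * Moments lying in a face *)

(** The constant 3 is 1 + 2: the rational center is within [1 / k.+1] of [x], and the ball of twice
    that radius about it must fit in [ball x e]. The doubling matches [face_moment_null_ball]. *)
Lemma rational_ball (R : realType) (n : nat) (x : 'rV[R]_n) (e : R) : 0 < e ->
  exists (q : 'rV[rat]_n) (k : nat),
    ball (map_mx ratr q : 'rV[R]_n) k.+1%:R^-1 x /\
    ball (map_mx ratr q : 'rV[R]_n) (2 * k.+1%:R^-1) `<=` ball x e.
Proof.
move=> e0; pose k := Num.truncn (3 / e).
have ke : 3 * k.+1%:R^-1 < e.
  rewrite ltr_pdivrMr// mulrC -ltr_pdivrMr//.
  by have /andP[] : k%:R <= 3 / e < k.+1%:R by apply: truncn_itv;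
    rewrite divr_ge0 ?(ltW e0).
have r0 : 0 < k.+1%:R^-1 :> R by [].
have /choice[q hq] : forall i, exists c : rat,
    ratr c \in `]x 0 i, x 0 i + k.+1%:R^-1[.
  by move=> i; apply: rat_in_itvoo; rewrite ltrDl.
exists (\row_i q i), k.
move: (k.+1%:R^-1) ke r0 hq => r ke r0 hq; split.
  split=> // i j; rewrite /ball /= ord1 !mxE; have := hq j;
    rewrite in_itv/= => /andP[h1 h2].
  by rewrite ger0_norm; lra.
move=> y [_ yq]; split=> // i j; rewrite ord1; have := yq 0 j;
  rewrite /ball/= !mxE => h.
have := hq j; rewrite in_itv/= => /andP[h1 h2].
move: h; rewrite !ltr_norml => /andP[h3 h4].
by apply/andP; split; lra.
Qed.

Section face_moments.
Context d (Z : measurableType d) (R : realType) (n : nat).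
Variables (mu : {sigma_finite_measure set Z -> \bar R}) (phi : Z -> 'rV[R]_n).
Hypothesis mphi : borel_measurable phi.
Variable F : set 'rV[R]_n.
Hypothesis faceF : face (phi_cone mu phi) F.
Implicit Types (g h : Z -> R).

Local Notation moment := (moment mu phi).
Local Notation Gplus := (Gplus mu phi).

(** A functional vanishing on [F] vanishes on its closure, hence annihilates the moment. The moment
    is therefore in the span of [F], and [face_row_span] brings it back into [F]. *)
Lemma face_moment_supported g : Gplus g ->
  (forall z, ~ closure F (phi z) -> g z = 0) -> F (moment g).
Proof.
move=> Gg gF; have coneC := convex_cone_phi_cone mu phi.
have Cg : phi_cone mu phi (moment g) by exists g.
apply: contrapT => nF.
have [m B FB|l [lF /eqP lg]] := @exists_annihilator _ _ F (moment g).
  by move/(face_row_span coneC faceF FB Cg).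
apply: lg; apply/matrixP => i j; rewrite !ord1 [RHS]mxE (moment_linear _ Gg.1).
rewrite /Rintegral integral0_eq// => z _.
have [Fz|/gF ->] := pselect (closure F (phi z)); last by rewrite mulr0.
suff -> : (phi z *m l) 0 0 = 0 by rewrite mul0r.
have cl : closed [set y : 'rV[R]_n | (y *m l) 0 0 = 0].
  apply: (@closed_comp _ _ (fun y : 'rV[R]_n => (y *m l) 0 0) [set 0]).
    by move=> y _; exact: continuous_mulmx.
  exact: closed_eq.
suff : closure F `<=` [set y : 'rV[R]_n | (y *m l) 0 0 = 0] by exact.
rewrite closureE; apply: smallest_sub => // y /lF /= ->.
by rewrite mxE.
Qed.

(* The barycenter of phi with respect to min (g, u), with u > 0 integrable,
   restricted to phi^-1 (ball x r), would be a point of F close to x. *)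
Lemma face_moment_null_ball g (x : 'rV[R]_n) (r : R) : 0 < r ->
  Gplus g -> F (moment g) -> ball x (2 * r) `&` F = set0 ->
  mu.-negligible [set z | ball x r (phi z) /\ 0 < g z].
Proof.
move=> r0 Gg Fg xF; have coneC := convex_cone_phi_cone mu phi.
have [F0 FD FZ] := face_convex_cone coneC faceF.
have [u [mu_ u0 iu]] := sigma_finite_integrable_gt0 mu.
set A := [set z | _]; have [[mg ig] g0] := Gg.
have mA : measurable A.
  apply: measurableI; first exact/measurable_preimage_open/ball_open.
  have := mg measurableT _ (measurable_itv `]0, +oo[); rewrite setTI.
  by congr measurable; apply/seteqP; split=> z /=; rewrite in_itv/= andbT.
pose h z := Num.min (g z) (u z) * \1_A z.
have mh : measurable_fun [set: Z] h.
  by apply: measurable_funM; [exact: measurable_minr|exact: measurable_indic].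
have h0 z : 0 <= h z by rewrite mulr_ge0// le_min g0 ltW.
have hmin z : h z <= Num.min (g z) (u z).
  by rewrite /h indicE; case: (_ \in _); rewrite ?mulr1 ?mulr0// le_min g0 ltW.
have hg z : h z <= g z by rewrite (le_trans (hmin z))// ge_min lexx.
have hu z : h z <= u z by rewrite (le_trans (hmin z))// ge_min lexx orbT.
have ih : mu.-integrable [set: Z] (EFin \o h).
  apply: le_integrable iu => //; first exact/measurable_EFinP.
  by move=> z _; rewrite !abse_EFin lee_fin !ger0_norm// ltW.
have Gh : Gplus h by apply: Gplus_le Gg => // z; rewrite h0 hg.
have Ggh : Gplus (g \+ (-1 \*o h)).
  split=> [|z]; last by rewrite /= mulN1r subr_ge0.
  by apply: GspaceD; [exact: Gg.1|apply: GspaceZ; exact: Gh.1].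
have Fh : F (moment h).
  apply: (face_summand coneC faceF (y := moment (g \+ (-1 \*o h)))).
  - by exists h.
  - by exists (g \+ (-1 \*o h)).
  - rewrite -momentD; [|exact: Gh.1|exact: Ggh.1].
    by rewrite (_ : _ \+ _ = g)//; apply/funext => z /=;
      rewrite mulN1r addrCA subrr addr0.
pose c := \int[mu]_z h z.
have c0 : 0 <= c by exact: Rintegral_ge0.
(* Integration keeps only a non-strict bound by [r], which is why the ball assumed disjoint from [F]
   has radius [2 * r]. *)
have near_x i : `|moment h 0 i - x 0 i * c| <= r * c.
  have ixh : mu.-integrable [set: Z] (EFin \o (fun z => x 0 i * h z)).
    exact: (integrableZl _ (x 0 i) ih).
  have iB := integrableB measurableT (Gh.1.2 i) ixh.
  rewrite mxE /c -!RintegralZl// -RintegralB//; last exact: Gh.1.2.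
  apply: (le_trans (le_normr_Rintegral _ _)) => //.
  apply: le_Rintegral => //.
  - exact: integrable_norm.
  - exact: (integrableZl _ r ih).
  - move=> z _; rewrite -mulrBl normrM (ger0_norm (h0 z)).
    have [Az|Az] := boolP (z \in A); last first.
      by rewrite /h indicE (negbTE Az) !mulr0.
    rewrite ler_wpM2r// distrC; apply: ltW.
    by move/set_mem : Az => [[_ /(_ 0 i)]].
have {c0} c0 : c = 0.
  apply: contrapT => /eqP cneq0.
  have {cneq0} c0 : 0 < c by rewrite lt_neqAle eq_sym cneq0.
  have : (ball x (2 * r) `&` F) (c^-1 *: moment h).
    split; last by apply: FZ => //; rewrite invr_ge0 ltW.
    split=> [|i j]; first by rewrite mulr_gt0.
    rewrite ord1 /ball /= distrC [X in `|X - _|]mxE.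
    rewrite -(ltr_pM2r c0) -[X in _ * X](ger0_norm (ltW c0)) -normrM mulrBl.
    rewrite mulrAC mulVf ?gt_eqF// mul1r (le_lt_trans (near_x j))//.
    by rewrite ltr_pM2r// ltr_pMl// ltr1n.
  by rewrite xF.
have : (\int[mu]_z `|(EFin \o h) z| = 0)%E.
  rewrite (eq_integral (EFin \o h)) => [|z _];
    last by rewrite abse_EFin ger0_norm.
  rewrite -(@fineK _ (\int[mu]_z (EFin \o h) z)%E);
    last exact: integrable_fin_num.
  by rewrite -[fine _]/c c0.
move/(ae_eq_integral_abs mu measurableT (measurable_int mu ih)).
apply: negligibleS => z Az /= /(_ I) [].
have [_ gz] := Az; apply/eqP; rewrite /h indicE mem_set// mulr1.
by rewrite gt_eqF// lt_min gz u0.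
Qed.

(** The complement of [closure F] is covered by countably many rational balls whose doubles miss
    [F]; each contributes a negligible set. *)
Lemma face_moment_null g : Gplus g -> F (moment g) ->
  mu.-negligible [set z | ~ closure F (phi z) /\ 0 < g z].
Proof.
move=> Gg Fg.
pose box (i : nat) : set Z :=
  if unpickle i is Some (q, k) then
    if `[< ball (map_mx ratr q : 'rV[R]_n) (2 * k.+1%:R^-1) `&` F = set0 >] then
      [set z | ball (map_mx ratr q : 'rV[R]_n) k.+1%:R^-1 (phi z) /\ 0 < g z]
    else set0
  else set0.
apply: (@negligibleS _ _ _ _ (\bigcup_i box i)); last first.
  apply: negligible_bigcup => i; rewrite /box.
  case: unpickle => [[q k]|]; last exact: negligible_set0.
  case: asboolP => [qF|_]; last exact: negligible_set0.
  exact: face_moment_null_ball.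
move=> z [nFz gz].
have [e /= e0 he] : exists2 e : R, 0 < e & ball (phi z) e `&` F = set0.
  move/existsNP: nFz => [B /not_implyP[/nbhs_ballP[e /= e0 eB] FB]].
  exists e => //; apply/seteqP; split=> // y [ye Fy]; apply: FB.
  by exists y; split=> //; exact: eB.
have [q [k [qz qe]]] := rational_ball (phi z) e0.
exists (pickle (q, k)) => //; rewrite /box pickleK; case: asboolP => //; case.
by apply/seteqP; split=> // y [/qe ye Fy]; rewrite -he.
Qed.

End face_moments.

(** * The effective domain *)

(** An integrable [u > 0] is damped by [expR (- s z)], where [s] dominates every coordinate of [phi]
    in absolute value and [s <= expR s]. *)
Lemma exists_Gplus_gt0 d (Z : measurableType d) (R : realType) (n : nat)
    (mu : {sigma_finite_measure set Z -> \bar R}) (phi : Z -> 'rV[R]_n) :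
  borel_measurable phi ->
  exists e : Z -> R, Gplus mu phi e /\ forall z, 0 < e z.
Proof.
move=> mphi; have [u [mu_ u0 iu]] := sigma_finite_integrable_gt0 mu.
have mc := measurable_coord mphi.
pose s z := \sum_i `|phi z 0 i|.
have ms : measurable_fun [set: Z] s.
  by apply: measurable_sum => i; apply: measurableT_comp => //; exact: mc.
pose e z := u z * expR (- s z).
have e0 z : 0 < e z by rewrite mulr_gt0// expR_gt0.
have me : measurable_fun [set: Z] e.
  apply: measurable_funM => //; apply: measurableT_comp => //.
  exact: measurableT_comp.
exists e; split=> //; split=> [|z]; last exact: ltW.
split=> // i; apply: le_integrable iu => //.
  by apply/measurable_EFinP; apply: measurable_funM => //; exact: mc.
move=> z _; rewrite !abse_EFin lee_fin normrM (gtr0_norm (e0 z)).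
rewrite (gtr0_norm (u0 z)).
rewrite mulrCA ler_piMr ?(ltW (u0 z))// expRN ler_pdivrMr ?expR_gt0// mul1r.
apply: le_trans (expR_ge1Dx _); rewrite ler_wpDl// /s (bigD1 i)//= lerDl.
exact: sumr_ge0.
Qed.

Section domain.
Context d (Z : measurableType d) (R : realType) (n : nat).
Variables (mu : {sigma_finite_measure set Z -> \bar R}) (phi : Z -> 'rV[R]_n).
Variable beta : Z -> R -> \bar R.
Hypotheses (mphi : borel_measurable phi) (Bbeta : classB beta).
Implicit Types (g h : Z -> R) (F : set 'rV[R]_n).

Local Notation moment := (moment mu phi).
Local Notation Gplus := (Gplus mu phi).

Let posH g : Z -> \bar R := (fun z => beta z (g z))^\+%E.

Let posH_ge0 g z : (0 <= posH g z)%E.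
Proof. exact: funepos_ge0. Qed.

Let measurable_posH g : Gplus g -> measurable_fun [set: Z] (posH g).
Proof.
by move=> [[mg _] g0]; apply: measurable_funepos; exact: measurable_classB.
Qed.

Lemma domJP a : domJ mu phi beta a <->
  exists g, [/\ Gplus g, moment g = a & (\int[mu]_z posH g z < +oo)%E].
Proof.
rewrite /domJ/= /J; split=> [/ereal_inf_lt[_ [g [Gg ga] <-]]|[g [Gg ga]]].
  by rewrite /H cintegral_lty => Hg; exists g.
rewrite -cintegral_lty => Hg; apply: le_lt_trans Hg.
by apply: ereal_inf_lbound; exists g.
Qed.

Let measurable_far F : measurable [set z | ~ closure F (phi z)].
Proof.
apply: (measurable_preimage_open mphi (U := ~` closure F)).
by rewrite openC; exact: closed_closure.
Qed.

Lemma domJ_sub_ri a : domJ mu phi beta a ->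
  exists2 F, Fbeta mu phi beta F & ri F a.
Proof.
move=> /domJP[g [Gg ga Hg]].
have [|F faceF riF] := face_of_point (convex_cone_phi_cone mu phi) (a := a).
  by exists g.
exists F => //; split=> //; apply/cintegral_lty; apply: le_lt_trans Hg.
have Fg : F (moment g) by rewrite ga; exact: ri_sub.
have mpos := measurable_posH Gg; have mF := measurable_far F.
set far := [set z | _].
apply: (@le_trans _ _ (\int[mu]_(z in far) posH g z)%E).
  rewrite le_eqVlt; apply/orP; left; apply/eqP; apply: ge0_ae_eq_integral => //.
  - by apply: measurable_funepos; apply: measurable_funTS; exact: Bbeta.1.
  - exact: measurable_funTS.
  apply: negligibleS (face_moment_null mphi faceF Gg Fg) => z /= zF.
  have Fz : ~ closure F (phi z) by move=> Fz; apply: zF => /(_ Fz).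
  split=> //; rewrite lt_neqAle Gg.2 andbT; apply/eqP => gz.
  by apply: zF => _; rewrite /posH !funeposE -gz.
exact: ge0_subset_integral.
Qed.

Section ri_sub_domJ.
Variables (F : set 'rV[R]_n) (a0 : 'rV[R]_n).
Hypothesis faceF : face (phi_cone mu phi) F.
Hypothesis oF : (omega mu phi beta F < +oo)%E.
Hypothesis dom0 : domJ mu phi beta a0.

Let near z := closure F (phi z).

Let admissible g := [/\ Gplus g, forall z, ~ near z -> g z = 0 &
  (\int[mu]_z posH g z < +oo)%E].

Let restr g := g \* \1_(near : set Z).

Let restrE g z : near z -> restr g z = g z.
Proof. by move=> nz; rewrite /restr /= indicE mem_set ?mulr1. Qed.

Let restr0 g z : ~ near z -> restr g z = 0.
Proof. by move=> nz; rewrite /restr /= indicE memNset ?mulr0. Qed.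

Let measurable_near : measurable (near : set Z).
Proof.
rewrite -[X in measurable X]setCK; apply: measurableC; exact: measurable_far.
Qed.

Let Gplus_restr g : Gplus g -> Gplus (restr g).
Proof.
move=> Gg; apply: (Gplus_le mphi) (Gg) => [|z].
  by apply: measurable_funM; [exact: Gg.1.1|exact: measurable_indic].
have [nz|nz] := pselect (near z); first by rewrite restrE// Gg.2 lexx.
by rewrite restr0// lexx Gg.2.
Qed.

Let posH_lty g (h1 h2 : Z -> \bar R) : Gplus g ->
  (forall z, 0 <= h1 z)%E -> (forall z, 0 <= h2 z)%E ->
  measurable_fun [set: Z] h1 -> measurable_fun [set: Z] h2 ->
  (\int[mu]_z h1 z < +oo)%E -> (\int[mu]_z h2 z < +oo)%E ->
  (forall z, posH g z <= h1 z + h2 z)%E -> (\int[mu]_z posH g z < +oo)%E.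
Proof.
move=> Gg h10 h20 mh1 mh2 ih1 ih2 gh.
apply: (@le_lt_trans _ _ (\int[mu]_z (h1 z + h2 z))%E).
  apply: ge0_le_integral => //; first exact: measurable_posH.
  exact: emeasurable_funD.
by rewrite ge0_integralD// lte_add_pinfty.
Qed.

(** Restricting a function of finite cost to [near] leaves its cost there unchanged; elsewhere the
    cost becomes that of [beta z 0], which the finiteness of [omega] pays for. *)
Let admissible_exists : exists g, admissible g.
Proof.
have [g [Gg _ Hg]] := (domJP a0).1 dom0.
exists (restr g); split=> [||]; first exact: Gplus_restr.
  exact: restr0.
move/cintegral_lty : oF; rewrite integral_mkcond => oF'.
have mfar := measurable_far F.
apply: (posH_lty (h1 := posH g)
  (h2 := ((beta ^~ 0%R)^\+ \_ [set z | ~ closure F (phi z)])%E)) => //.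
- exact: Gplus_restr.
- by move=> z; apply: erestrict_ge0.
- exact: measurable_posH.
- apply/(measurable_restrictT _ mfar); apply: measurable_funTS.
  by apply: measurable_funepos; exact: Bbeta.1.
move=> z; have [nz|nz] := pselect (near z).
  rewrite /posH !funeposE restrE// -[leLHS]adde0 leeD//.
  by apply: erestrict_ge0.
rewrite /posH !funeposE restr0// -[leLHS]add0e leeD//;
  first by rewrite le_max lexx orbT.
by rewrite patchE mem_set// funeposE.
Qed.

(** By quasiconvexity the positive part at a mixture is at most the larger of the two positive
    parts, hence at most their sum. *)
Let admissible_convex : convex_set
  ([set moment g | g in admissible] : set (convex_lmodType 'rV[R]_n)).
Proof.
apply/convex_rVP => _ _ t [g [Gg gn Hg] <-] [h [Gh hn Hh] <-] t0 t1.
have t1' : 0 <= 1 - t by rewrite subr_ge0.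
have Gt := GplusZ t0 Gg; have Gt' := GplusZ t1' Gh.
have Ggh := GplusD Gt Gt'.
exists ((t \*o g) \+ ((1 - t) \*o h)); last first.
  by rewrite momentD ?momentZ//;
    [exact: Gh.1|exact: Gg.1|exact: Gt.1|exact: Gt'.1].
split=> // [z nz|]; first by rewrite /= gn// hn// !mulr0 addr0.
apply: (posH_lty (h1 := posH g) (h2 := posH h)) => //;
  try exact: measurable_posH.
move=> z; set k := _ \+ _.
have : (beta z (k z) <= maxe (beta z (g z)) (beta z (h z)))%E.
  have g0 := Gg.2 z; have h0 := Gh.2 z; rewrite /k /=.
  have [gh|/ltW hg] := leP (g z) (h z).
    by apply: (classGamma_quasiconvex (Bbeta.2 z)) => //; nra.
  by rewrite maxC; apply: (classGamma_quasiconvex (Bbeta.2 z)) => //; nra.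
rewrite /posH !funeposE le_max => /orP[kz|kz];
  rewrite ge_max adde_ge0 ?le_max ?lexx ?orbT// andbT.
  by rewrite -[leLHS]adde0 leeD// le_max ?kz ?lexx ?orbT.
by rewrite -[leLHS]add0e leeD// le_max ?kz ?lexx ?orbT.
Qed.

(* A functional bounded below by c on the moments of admissible functions is
   bounded below by c on F: perturb g to be positive where phi is close to F,
   then switch to a fixed admissible g0 wherever beta (g) is too large. *)
Let admissible_dense (l : 'cV[R]_n) (c : R) x :
  (forall g, admissible g -> c <= (moment g *m l) 0 0) ->
  F x -> c <= (x *m l) 0 0.
Proof.
move=> cl Fx; have [_ _ /(_ _ Fx)[g Gg gx] _] := faceF.
have [g0 [Gg0 g0n Hg0]] := admissible_exists.
have [e [Ge e0]] := exists_Gplus_gt0 mu mphi.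
have [u [mu_ u0 iu]] := sigma_finite_integrable_gt0 mu.
(* [g] already vanishes almost everywhere off [near] because its moment is in [F], so restricting it
   costs nothing. *)
have moment_g : moment (restr g) = x.
  rewrite -gx; apply: moment_ae_eq; [exact: (Gplus_restr Gg).1|exact: Gg.1|].
  have Fg : F (moment g) by rewrite gx.
  apply: negligibleS (face_moment_null mphi faceF Gg Fg) => z /= zg.
  have nz : ~ near z by move=> nz; move: zg; rewrite restrE// eqxx.
  split=> //; rewrite lt_neqAle Gg.2 andbT.
  by move: zg; rewrite restr0.
have main (t : R) : 0 < t ->
    c <= (x *m l) 0 0 + t * (moment (restr e) *m l) 0 0.
  move=> t0; have Gte := GplusZ (ltW t0) (Gplus_restr Ge).
  (* Adding [t] times a positive function makes [h > 0] on [near], where [beta z (h z)] is then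
     finite; [t] tends to [0] at the end. *)
  pose h := restr g \+ (t \*o restr e).
  have Gh : Gplus h by apply: GplusD => //; exact: Gplus_restr.
  have -> : (x *m l) 0 0 + t * (moment (restr e) *m l) 0 0 =
      (moment h *m l) 0 0.
    rewrite momentD; [|exact: (Gplus_restr Gg).1|exact: Gte.1].
    rewrite momentZ; last exact: (Gplus_restr Ge).1.
    by rewrite moment_g mulmxDl -scalemxAl [RHS]mxE [X in _ = _ + X]mxE.
  have h0 := Gh.2.
  have hn z : ~ near z -> h z = 0.
    by move=> nz; rewrite /h/= !restr0// mulr0 addr0.
  have hpos z : near z -> 0 < h z.
    by move=> nz; rewrite /h/= !restrE// ltr_wpDl ?Gg.2// mulr_gt0.
  have mbh : measurable_fun [set: Z] (fun z => beta z (h z)).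
    by apply: measurable_classB => //; exact: Gh.1.1.
  (* The positive part of the cost of [f m] is at most [m * u] plus that of [g0], hence integrable,
     while [f m] is dominated by [h + g0] and converges to [h]. *)
  pose f (m : nat) z := if (beta z (h z) <= (m%:R * u z)%:E)%E
    then h z else g0 z.
  have mmu m : measurable_fun [set: Z] (fun z => (m%:R * u z)%:E).
    by apply/measurable_EFinP; exact: measurable_funM.
  have mf m : measurable_fun [set: Z] (f m).
    apply: measurable_fun_ifT; [|exact: Gh.1.1|exact: Gg0.1.1].
    exact: measurable_fun_lee.
  have f_ge0 m z : 0 <= f m z by rewrite /f; case: ifP; rewrite ?h0 ?Gg0.2.
  have f_le m z : f m z <= (h \+ g0) z.
    by rewrite /f/=; case: ifP => _; rewrite ?lerDl ?lerDr ?h0 ?Gg0.2.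
  have Ghg0 := GplusD Gh Gg0.
  have Gf m : Gplus (f m).
    by apply: (Gplus_le mphi) Ghg0 => // z; rewrite f_ge0 f_le.
  have adm m : admissible (f m).
    split=> // [z nz|]; first by rewrite /f hn// g0n//; case: ifP.
    apply: (posH_lty (h1 := fun z => (m%:R * u z)%:E) (h2 := posH g0)) => //.
    - by move=> z; rewrite lee_fin mulr_ge0// ltW.
    - exact: measurable_posH.
    - by apply: integrable_lty => //; exact: (integrableZl _ m%:R iu).
    - move=> z; have mu0 : (0 <= (m%:R * u z)%:E)%E.
        by rewrite lee_fin mulr_ge0// ltW.
      rewrite {1}/posH funeposE /f; case: ifPn => [hz|_].
        by rewrite -[leLHS]adde0 leeD// ge_max hz mu0.
      by rewrite -[leLHS]add0e leeD// /posH funeposE.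
  have fh z : f ^~ z @ \oo --> h z.
    have [nz|nz] := pselect (near z); last first.
      rewrite (_ : f ^~ z = cst 0) ?hn//; first exact: cvg_cst.
      by apply/funext => m; rewrite /f hn// g0n//; case: ifP.
    apply: cvg_near_cst; have hz := hpos _ nz.
    (* Once [m] exceeds [beta z (h z) / u z], the test succeeds and [f m z] is exactly [h z]. *)
    exists (Num.truncn (fine (beta z (h z)) / u z)).+1 => //= m /= hm.
    rewrite /f (classGammaE (Bbeta.2 z) hz) lee_fin -ler_pdivrMr// ifT//.
    have [hlt0|hge0] := leP (fine (beta z (h z)) / u z) 0.
      exact: le_trans hlt0 _.
    have /andP[_ /ltW h2] := truncn_itv (ltW hge0).
    by rewrite (le_trans h2)// ler_nat.
  have cvgl : (moment (f m) *m l) 0 0 @[m --> \oo] --> (moment h *m l) 0 0.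
    rewrite mxE; under eq_fun do rewrite mxE.
    apply: cvg_big => [|i _]; first exact: add_continuous.
    apply: cvgMr_tmp; apply: (cvg_moment mphi (h := h \+ g0)) => //.
    - exact: Gh.1.
    - exact: Ghg0.1.
    - by move=> m z; rewrite ger0_norm.
  by apply: (cvgr_to_ge cvgl); apply: nearW => m; exact: cl.
apply/ler_addgt0Pr => r r0.
set s := (moment (restr e) *m l) 0 0 in main.
apply: (le_trans (main (r / (`|s| + 1)) _)).
  by rewrite divr_gt0// ltr_wpDl.
rewrite lerD2l mulrAC ler_pdivrMr ?ltr_wpDl// ler_pM2l//.
by rewrite (le_trans (ler_norm _))// lerDl.
Qed.

Lemma ri_sub_domJ : ri F `<=` domJ mu phi beta.
Proof.
move=> a riFa.
suff : [set moment g | g in admissible] a.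
  by move=> [g [Gg _ Hg] ga]; apply/domJP; exists g.
apply: contrapT => Da.
have [|l [la [_ [g adm_g <-] lg]]] := convex_separation admissible_convex _ Da.
  by have [g Ag] := admissible_exists; exists (moment g), g.
have lF x : F x -> (a *m l) 0 0 <= (x *m l) 0 0.
  by apply: admissible_dense => h Ah; apply: la; exists h.
have Fg : F (moment g) by case: adm_g => Gg gn _; exact: face_moment_supported.
(* Prolonging the segment from [moment g] through [a] stays in [F], but there [l] falls strictly
   below its value at [a], because [l] is larger at [moment g]. *)
have [t t0 /lF] := ri_core riFa Fg.
have -> : ((a + t *: (a - moment g)) *m l) 0 0 =
    (a *m l) 0 0 + t * ((a *m l) 0 0 - (moment g *m l) 0 0).
  rewrite mulmxDl -scalemxAl mulmxBl [LHS]mxE [X in _ + X = _]mxE.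
  by rewrite [X in _ + t * X = _]mxE [X in _ + t * (_ + X) = _]mxE.
by rewrite lerDl pmulr_rge0// subr_ge0 leNgt lg.
Qed.

End ri_sub_domJ.
End domain.

Theorem theorem6p8 (d : measure_display) (Z : measurableType d) (R : realType)
    (n : nat) (mu : {sigma_finite_measure set Z -> \bar R})
    (phi : Z -> 'rV[R]_n) (beta : Z -> R -> \bar R)
    (mphi : borel_measurable phi) (Bbeta : classB beta)
    (domJ0 : domJ mu phi beta !=set0) :
  domJ mu phi beta = \bigcup_(F in Fbeta mu phi beta) ri F.
Proof.
apply/seteqP; split=> a.
  by move/(domJ_sub_ri mphi Bbeta) => [F BF riF]; exists F.
have [a0 dom0] := domJ0; move=> [F [faceF oF] riF].
exact: (ri_sub_domJ mphi Bbeta faceF oF dom0).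
Qed.
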